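(* Let $n\ge 1$ be an integer, let $\{v_k\}$ be the basis of $W_n$ consisting of the isomorphism classes of Gauss words of length $2n$, and let $x_k$ be parameters. For a pointed closed curve $\Gamma$ on an oriented surface put $$I_n(\Gamma)=\Big\langle \sum_k x_k v_k,\; w_\Gamma\Big\rangle .$$ Then $I_n$ is a surface isotopy invariant of pointed closed curves: if two pointed closed curves $\Gamma,\Gamma'$ on the same oriented surface are related by an ambient isotopy of the surface (respecting orientations of the curves and base points), then $I_n(\Gamma)=I_n(\Gamma')$.
   Context: All surfaces and curves are oriented. A closed curve on a surface $\Sigma$ is an immersion $S^1\to\Sigma$ whose only singular points are transversal double points. A base point is a point of the curve that is not a double point; a pointed closed curve is a closed curve with a base point. A Gauss word of length $2n$ is a word (finite sequence of letters) in an alphabet of $n$ letters in which each letter occurs exactly twice. Two words are isomorphic if a bijection of their alphabets carries one to the other. $W_n$ is the free $\mathbf{Q}$-module generated by the isomorphism classes of Gauss words of length $2n$. A nanoword over $\{-1,1\}$ is a Gauss word $w$ in an alphabet $\mathcal{A}_w$ together with a map $\mathrm{sign}:\mathcal{A}_w\to\{-1,1\}$. For a pointed closed curve $\Gamma$, the nanoword $w_\Gamma$ is obtained by labelling the double points by distinct letters and reading the labels along $\Gamma$ from the base point, each double point being met twice. If $t_1,t_2$ are the tangent vectors of $\Gamma$ at a double point $A$ on the first and second passage, then $\mathrm{sign}\,A=+1$ if $(t_1,t_2)$ is a negatively oriented frame and $\mathrm{sign}\,A=-1$ if it is positively oriented. For a Gauss word $v$ and a nanoword $w$, $$\langle v,w\rangle=\sum_{v'}\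 \prod_{A\in\mathcal{A}_{v'}}\mathrm{sign}\,A,$$ the sum being over all sub-words $v'$ of $w$ (obtained by choosing a subset $\mathcal{A}_{v'}\subset\mathcal{A}_w$ of letters and deleting all occurrences of the other letters) that are isomorphic to $v$. This is extended linearly in the first argument (with parameters as coefficients). *)

(* Defs.v *)
From HB Require Import structures.
From mathcomp Require Import all_boot all_order all_algebra.
From mathcomp Require Import generic_quotient.
From mathcomp Require Import finmap.
From mathcomp Require Import zify lra.
From mathcomp Require Import all_classical all_reals all_analysis.

Set Implicit Arguments.
Unset Strict Implicit.
Unset Printing Implicit Defensive.

Import Order.TTheory GRing.Theory Num.Theory.
Import numFieldNormedType.Exports.

Local Open Scope classical_set_scope.
Local Open Scope ring_scope.
Local Open Scope quotient_scope.

(* The alphabet of a word is the set of letters occurring in it, so the ambient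
   type of letters may be larger than the alphabet. *)
Definition gauss_word (T : eqType) (w : seq T) : bool :=
  all (fun a => count_mem a w == 2) w.

Definition word_iso (T U : eqType) (v : seq T) (w : seq U) : Prop :=
  exists f : T -> U, {in v &, injective f} /\ w = map f v.

(* Up to isomorphism, the alphabet of n letters is 'I_n. *)
Definition gauss (n : nat) := {w : n.*2.-tuple 'I_n | gauss_word w}.

Definition gauss_iso (n : nat) (v w : gauss n) : bool :=
  `[< word_iso (val v : seq 'I_n) (val w : seq 'I_n) >].

Lemma gauss_iso_refl n : reflexive (@gauss_iso n).
Proof.
by move=> v; apply/asboolP; exists id; split; [move=> ? ? | rewrite map_id].
Qed.

Lemma word_iso_sym (T : eqType) (v w : seq T) : word_iso v w -> word_iso w v.
Proof.
move=> [f [finj ->]].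
pose g b := nth b v (index b (map f v)).
have gK a : a \in v -> g (f a) = a.
  move=> av; have fav : f a \in map f v by exact: map_f.
  have iv : (index (f a) (map f v) < size v)%N by rewrite -(size_map f) index_mem.
  apply: finj => //; first exact: mem_nth.
  by rewrite -(nth_map (f a) (f a) f) // nth_index.
exists g; split.
  by move=> _ _ /mapP[a av ->] /mapP[b bv ->]; rewrite !gK // => ->.
by rewrite -map_comp -[LHS]map_id; apply/eq_in_map => a av /=; rewrite gK.
Qed.

Lemma gauss_iso_sym n : symmetric (@gauss_iso n).
Proof. by move=> v w; apply/asboolP/asboolP; exact: word_iso_sym. Qed.

Lemma gauss_iso_trans n : transitive (@gauss_iso n).
Proof.
move=> v u w /asboolP[f [finj vE]] /asboolP[g [ginj wE]]; apply/asboolP.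
exists (g \o f); split; last by rewrite wE vE map_comp.
move=> a b au bu /= /ginj gE; apply: finj => //.
by apply: gE; rewrite vE map_f.
Qed.

Definition gauss_equiv (n : nat) : equiv_rel (gauss n) :=
  EquivRel (@gauss_iso n) (@gauss_iso_refl n) (@gauss_iso_sym n)
    (@gauss_iso_trans n).

Definition gauss_class (n : nat) := {eq_quot gauss_equiv n}.

HB.instance Definition _ n := EqQuotient.on (gauss_class n).
HB.instance Definition _ n :=
  Finite.copy (gauss_class n) (can_type (@EquivQuot.ereprK _ _ _ _ _
    (defaultEncModRel (gauss_equiv n)))).

(* P (x)_Q W_n for a commutative Q-algebra P of parameters; the case P = Q is
   W_n itself, and for indeterminates x_k one takes P = Q[x_1, ..., x_N]. *)
Definition W (P : comAlgType rat) (n : nat) := {ffun gauss_class n -> P^o}.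

Definition W_basis (P : comAlgType rat) (n : nat) (k : gauss_class n) : W P n :=
  [ffun l => (l == k)%:R].

Record nanoword (T : choiceType) := Nanoword {
  nword :> seq T;
  nwordP : gauss_word nword;
  nsign : T -> int;
  nsignP : forall a, a \in nword -> nsign a = 1 \/ nsign a = -1
}.

Definition alphabet (T : choiceType) (w : seq T) : {fset T} := [fset a in w]%fset.

Definition subword (T : choiceType) (w : seq T) (S : {fset T}) : seq T :=
  [seq a <- w | a \in S].

Definition pairing (U : eqType) (T : choiceType) (v : seq U) (w : nanoword T) : int :=
  \sum_(S <- fpowerset (alphabet w) | `[< word_iso v (subword w S) >])
    \prod_(a <- S) nsign w a.

Definition pairing_lin (P : comAlgType rat) (n : nat) (T : choiceType)
    (c : W P n) (w : nanoword T) : P :=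
  \sum_(k : gauss_class n)
    c k * (pairing (val (repr k : gauss n) : seq 'I_n) w)%:~R.

Fixpoint Ck (R : realType) (V W : normedModType R) (k : nat) (U : set V)
    (f : V -> W) : Prop :=
  if k is k'.+1 then
    (forall x, U x -> differentiable f x) /\
    (forall v, Ck k' U (fun x => 'd f x v))
  else forall x, U x -> {for x, continuous f}.

(* Smoothness on an arbitrary subset A, by local extensions. For A open this
   is the usual notion; it is needed in this form only for A = [0, 1] * U. *)
Definition smooth_on (R : realType) (V W : normedModType R) (A : set V)
    (f : V -> W) : Prop :=
  forall x, A x -> exists (U : set V) (g : V -> W),
    [/\ open U, U x, forall k, Ck k U g & forall y, A y -> U y -> f y = g y].

Record chart (R : realType) (T : topologicalType) := Chart {
  cdom : set T;
  cmap :> T -> 'rV[R]_2;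
  cimg : set 'rV[R]_2;
  cinv : 'rV[R]_2 -> T;
  cdom_open : open cdom;
  cimg_open : open cimg;
  cmap_img : forall p, cdom p -> cimg (cmap p);
  cinv_dom : forall u, cimg u -> cdom (cinv u);
  cmapK : forall p, cdom p -> cinv (cmap p) = p;
  cinvK : forall u, cimg u -> cmap (cinv u) = u;
  cmap_continuous : forall p, cdom p -> {for p, continuous cmap};
  cinv_continuous : forall u, cimg u -> {for u, continuous cinv}
}.

(* Two-dimensional manifolds without boundary; neither compactness nor
   connectedness is required. The charts of the atlas are the positive ones. *)
Record surface (R : realType) := Surface {
  points :> topologicalType;
  atlas : set (chart R points);
  surface_hausdorff : hausdorff_space points;
  surface_second_countable : @second_countable points;
  atlas_cover : forall p : points, exists2 c, atlas c & cdom c p;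
  atlas_smooth : forall c d, atlas c -> atlas d ->
    smooth_on [set u | cimg c u /\ cdom d (cinv c u)] (d \o cinv c);
  atlas_oriented : forall c d u, atlas c -> atlas d ->
    cimg c u -> cdom d (cinv c u) -> 0 < \det ('J (d \o cinv c) u)
}.

(* Smoothness on A of a map from a subset A of a normed space to a surface. *)
Definition smooth_to (R : realType) (V : normedModType R) (S : surface R)
    (A : set V) (f : V -> S) : Prop :=
  {within A, continuous f} /\
  forall c, @atlas R S c -> smooth_on (A `&` f @^-1` cdom c) (c \o f).

Definition smooth_map (R : realType) (S : surface R) (f : S -> S) : Prop :=
  forall c, @atlas R S c -> smooth_to (cimg c) (f \o cinv c).

Definition diffeomorphism (R : realType) (S : surface R) (f : S -> S) : Prop :=
  exists g : S -> S,
    [/\ cancel f g, cancel g f, smooth_map f & smooth_map g].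

Definition ambient_isotopy (R : realType) (S : surface R) (F : R -> S -> S) : Prop :=
  [/\ forall p, F 0 p = p,
      forall t, 0 <= t <= 1 -> diffeomorphism (F t) &
      forall c, @atlas R S c ->
        smooth_to [set tu : R * 'rV[R]_2 | 0 <= tu.1 <= 1 /\ cimg c tu.2]
          (fun tu => F tu.1 (cinv c tu.2))].

(* The oriented circle is R/Z, with its orientation from R: maps from the
   circle are 1-periodic maps on R. *)
Definition same_time (R : realType) (s t : R) : Prop := s - t \is a Num.int.

Definition velocity (R : realType) (S : surface R) (c : chart R S) (G : R -> S)
    (s : R) : 'rV[R]_2 := derive1 (c \o G) s.

Definition frame_det (R : realType) (S : surface R) (c : chart R S) (G : R -> S)
    (s t : R) : R := \det (col_mx (velocity c G s) (velocity c G t)).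

Record closed_curve (R : realType) (S : surface R) := ClosedCurve {
  curve :> R -> S;
  curve_periodic : forall s, curve (s + 1) = curve s;
  curve_smooth : smooth_to setT curve;
  curve_immersion : forall c s, @atlas R S c -> cdom c (curve s) ->
    velocity c curve s != 0;
  curve_double : forall s t u, curve s = curve t -> curve t = curve u ->
    [\/ same_time s t, same_time t u | same_time s u];
  curve_transversal : forall c s t, @atlas R S c -> cdom c (curve s) ->
    curve s = curve t -> ~ same_time s t -> frame_det c curve s t != 0
}.

Definition passes_double (R : realType) (S : surface R) (G : R -> S) (s : R) : Prop :=
  exists2 t, ~ same_time s t & G s = G t.

Record pointed_curve (R : realType) (S : surface R) := PointedCurve {
  pcurve :> closed_curve S;
  base : R;
  baseP : ~ passes_double pcurve base
}.

(* The passages through double points during one turn from the base point, in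
   order of time. The set of these is finite, since the circle is compact and
   double points of an immersion are isolated when transversal; so fset_set
   does not take its default value. *)
Definition passages (R : realType) (S : surface R) (G : pointed_curve S) : seq R :=
  sort <=%O
    (fset_set [set s | base G < s < base G + 1 /\ passes_double G s]).

(* The letter labelling a double point is this point itself. *)
Definition curve_word (R : realType) (S : surface R) (G : pointed_curve S) : seq S :=
  [seq G s | s <- passages G].

(* (t_1, t_2) is a negatively oriented frame of the tangent plane at p. *)
Definition negative_crossing (R : realType) (S : surface R) (G : pointed_curve S)
    (p : S) : Prop :=
  exists s1 s2 (c : chart R S),
    [/\ base G < s1, s1 < s2, s2 < base G + 1, G s1 = p & G s2 = p] /\
    [/\ atlas c, cdom c p & frame_det c G s1 s2 < 0].

Definition curve_sign (R : realType) (S : surface R) (G : pointed_curve S)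
    (p : S) : int :=
  if `[< negative_crossing G p >] then 1 else -1.

Lemma curve_signP (R : realType) (S : surface R) (G : pointed_curve S) (p : S) :
  p \in curve_word G -> curve_sign G p = 1 \/ curve_sign G p = -1.
Proof. by move=> _; rewrite /curve_sign; case: ifP; [left | right]. Qed.

Section CurveWordGauss.
Variables (R : realType) (S : surface R) (G : pointed_curve S).

Lemma curve_periodicZ (s : R) (m : int) : G (s + m%:~R) = G s.
Proof.
have per (k : nat) u : G (u + k%:R) = G u.
  elim: k u => [|k IHk] u; first by rewrite addr0.
  by rewrite -natr1 addrA curve_periodic IHk.
case: m => k; first exact: per.
by rewrite NegzE mulrNz -[in RHS](subrK (k.+1%:R : R) s) per.
Qed.

Lemma same_time_eq (s t : R) : base G < s < base G + 1 ->
  base G < t < base G + 1 -> same_time s t -> s = t.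
Proof.
move=> /andP[bs sb] /andP[bt tb] /intrP[m mE]; apply/eqP.
have m1 : (m%:~R : R) < 1%:~R by rewrite -mE; lra.
have m2 : ((- 1)%:~R : R) < m%:~R by rewrite -mE; lra.
rewrite !ltr_int in m1 m2; have m0 : m = 0 by lia.
by rewrite -subr_eq0 mE m0.
Qed.

Lemma same_time_sym (s t : R) : same_time s t -> same_time t s.
Proof. by rewrite /same_time -opprB rpredN. Qed.

Lemma same_time_trans (s t u : R) :
  same_time s t -> same_time t u -> same_time s u.
Proof.
by rewrite /same_time => st tu; rewrite -(subrKA t) rpredD.
Qed.

Let D := [set s | base G < s < base G + 1 /\ passes_double G s].

Lemma partner (s : R) : D s -> exists2 t, D t & s != t /\ G s = G t.
Proof.
move=> [sb [t st Gst]].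
pose t' := t - (Num.floor (t - base G))%:~R.
have tt' : same_time t t' by rewrite /same_time /t' opprB addrC subrK.
have Gt' : G t' = G t by rewrite /t' -mulrNz curve_periodicZ.
have st' : ~ same_time s t'.
  by move=> h; apply/st/(same_time_trans h)/same_time_sym.
have [f1 f2] := (floor_le (t - base G), floorD1_gt (t - base G)).
rewrite intrD in f2.
have t'D : base G < t'.
  rewrite lt_neqAle; apply/andP; split; last by rewrite /t'; lra.
  apply/eqP => bE; apply: (@baseP _ _ G).
  exists s; first by rewrite bE => /same_time_sym.
  by rewrite bE Gt' -Gst.
exists t'.
  split; first by rewrite t'D /= /t'; move: f2; lra.
  by exists s; [move=> /same_time_sym | rewrite Gt'].
split; last by rewrite Gt'.
by apply/eqP => sE; apply: st'; rewrite sE /same_time subrr.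
Qed.

Lemma curve_word_gauss : gauss_word (curve_word G).
Proof.
rewrite /gauss_word /curve_word /passages -/D.
have [Dfin|Dinf] := pselect (finite_set D); last first.
  by rewrite /fset_set; case: pselect.
set r := sort _ _.
have rD s : (s \in r) = (s \in D) by rewrite mem_sort in_fset_set.
have ur : uniq r by rewrite sort_uniq fset_uniq.
apply/allP => _ /mapP[s sr ->].
have Ds : D s by apply/set_mem; rewrite -rD.
have [t Dt [st Gst]] := partner Ds.
rewrite count_map -size_filter.
have -> // : size [seq u <- r | preim G (pred1 (G s)) u] = size [:: s; t].
apply: perm_size; apply: uniq_perm; first exact: filter_uniq.
  by rewrite /= inE st.
move=> u; rewrite mem_filter !inE rD; apply/andP/orP => /=.
  move=> [/eqP Gu /set_mem Du].
  have [us|sts|ut] := curve_double Gu Gst.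
  - by left; apply/eqP; apply: same_time_eq us; [case: Du|case: Ds].
  - by case/negP: st; apply/eqP; apply: same_time_eq sts; [case: Ds|case: Dt].
  - by right; apply/eqP; apply: same_time_eq ut; [case: Du|case: Dt].
by move=> [/eqP->|/eqP->]; rewrite ?Gst eqxx; split => //; exact/mem_set.
Qed.

End CurveWordGauss.

Definition curve_nanoword (R : realType) (S : surface R) (G : pointed_curve S) :
    nanoword S :=
  Nanoword (curve_word_gauss G) (@curve_signP R S G).

Definition I_ (R : realType) (S : surface R) (n : nat) (P : comAlgType rat)
    (x : gauss_class n -> P) (G : pointed_curve S) : P :=
  pairing_lin (\sum_(k : gauss_class n) (x k : P^o) *: W_basis P k)
    (curve_nanoword G).

(* A map f : S -> S carries G to G' as an oriented curve with base point; the
   parametrizations may differ by an orientation-preserving diffeomorphism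
   phi of the circle. *)
Definition carries (R : realType) (S : surface R) (f : S -> S)
    (G G' : pointed_curve S) : Prop :=
  f (G (base G)) = G' (base G') /\
  exists phi : R -> R,
    [/\ smooth_on setT phi, forall s, phi (s + 1) = phi s + 1,
        forall s, 0 < derive1 phi s & forall s, f (G s) = G' (phi s)].

Definition surface_isotopic (R : realType) (S : surface R)
    (G G' : pointed_curve S) : Prop :=
  exists2 F : R -> S -> S, ambient_isotopy F & carries (F 1) G G'.

(* Main.v *)
Require Import Defs.
From mathcomp Require Import all_boot all_order all_algebra.
From mathcomp Require Import finmap.
From mathcomp Require Import lra.
From mathcomp Require Import all_classical all_reals all_analysis.

(** The value of I_n depends on the nanoword only up to a bijective relabelling
    of letters that preserves signs, so it suffices to show that the final map
    f of the isotopy relabels the nanoword of G into that of G'.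

    The word.  The reparametrization of the circle lifts to a strictly
    increasing h : R -> R commuting with the translation by 1.  As the base
    points correspond and are not double points, h can be shifted by an integer
    so as to send the base time of G to that of G'; then it maps one turn of G
    onto one turn of G', preserving the order of times.  Since f is injective,
    double points go to double points.  Hence h carries the list of passages of
    G to that of G', and f carries the word of G to the word of G'
    ([passages_lift], [curve_word_lift]).

    The signs.  By the chain rule, the velocity vectors of G' are the images of
    those of G by the Jacobian of f, up to the positive factor h'.  So the sign
    of a crossing is multiplied by the sign of the Jacobian determinant of f in
    positive charts ([frame_det_lift], [curve_sign_lift]), which is positive:
    along the path t |-> F t p this determinant does not vanish, because each
    F t is a diffeomorphism; in a fixed chart it varies continuously with t,
    and its sign does not depend on the chart.  The sign is therefore locally
    constant on [0, 1], and it is positive for F 0 = id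
    ([isotopy_local_jacobian_gt0]). *)

Set Implicit Arguments.
Unset Strict Implicit.
Unset Printing Implicit Defensive.

Import Order.TTheory GRing.Theory Num.Theory.
Import numFieldNormedType.Exports.

Local Open Scope classical_set_scope.
Local Open Scope ring_scope.

(** * Differentials *)

(** The differential is selected by a choice operator, so locality does not
    hold by definition; it follows from the uniqueness of the linear part of a
    first-order expansion. *)
Lemma near_eq_diff (R : numFieldType) (V W : normedModType R) (f g : V -> W)
    (x : V) : (\forall y \near x, f y = g y) -> differentiable g x ->
  differentiable f x /\ 'd f x = 'd g x :> (V -> W).
Proof.
move=> fg dg.
have fE : f \o shift x = cst (f x) + 'd g x +o_ 0 id.
  apply/eqaddoP => e e0.
  have /eqaddoP/(_ e e0) gE := diff_locally dg.
  have fg0 : \forall h \near (0 : V), f (h + x) = g (h + x).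
    move: fg; rewrite (near_shift 0 x) /=; apply: filterS => h /=.
    by rewrite subr0.
  near=> h.
  have -> : (f \o shift x - (cst (f x) + 'd g x)) h =
      (g \o shift x - (cst (g x) + 'd g x)) h.
    rewrite !fctE /= (nbhs_singleton fg); congr (_ - _).
    by near: h.
  by near: h.
have dfE : 'd f x = 'd g x :> (V -> W).
  by apply: diff_unique fE; exact: diff_continuous.
split=> //; apply/diff_locallyP; rewrite dfE.
by split=> //; exact: diff_continuous.
Unshelve. all: by end_near. Qed.

Lemma smooth_on_differentiable (R : realType) (V W : normedModType R)
    (A : set V) (f : V -> W) (x : V) :
  smooth_on A f -> nbhs x A -> differentiable f x.
Proof.
move=> fs Ax; have [U [g [oU Ux gs fg]]] := fs x (nbhs_singleton Ax).
apply: (near_eq_diff (g := g) _ _).1; last by have [+ _] := gs 1%N; apply.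
near=> y; apply: fg; near: y => //.
exact: open_nbhs_nbhs.
Unshelve. all: by end_near. Qed.

Lemma pairl_continuous (T U : topologicalType) (y : U) :
  continuous (fun x : T => (x, y)).
Proof. by move=> x; apply: cvg_pair; [exact: cvg_id | exact: cvg_cst]. Qed.

Lemma pairr_continuous (T U : topologicalType) (x : T) :
  continuous (fun y : U => (x, y)).
Proof. by move=> y; apply: cvg_pair; [exact: cvg_cst | exact: cvg_id]. Qed.

(** Here A may be a half-neighbourhood in the time direction, as at the ends of
    [0, 1].  The slices A t around u being full neighbourhoods, a smooth
    extension g of H has there the same space derivative as H, and the space
    derivative of g is defined and continuous in t on both sides of t0. *)
Lemma smooth_on_slice (R : realType) (V W : normedModType R)
    (A : set (R * V)) (H : R -> V -> W) (t0 : R) (u : V) :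
  smooth_on A (fun tu => H tu.1 tu.2) -> A (t0, u) ->
  (forall t, A (t, u) -> \forall w \near u, A (t, w)) ->
  exists D : R -> V -> W, (forall v, {for t0, continuous (D^~ v)}) /\
    \forall t \near t0, A (t, u) -> 'd (H t) u = D t :> (V -> W).
Proof.
move=> Hs A0 Aslice; have [U [g [oU U0 gs Hg]]] := Hs _ A0.
have [gd gc] := gs 1%N.
have pairc (t : R) : {for u, continuous (fun w => (t, w) : R * V)}.
  exact: pairr_continuous.
have pairc' : {for t0, continuous (fun t : R => (t, u) : R * V)}.
  exact: pairl_continuous.
exists (fun t v => 'd g (t, u) (0, v)); split=> [v|].
  apply: (@continuous_comp _ _ _ (fun t : R => (t, u) : R * V)
    (fun p => 'd g p (0, v)) t0) => //.
  exact: (gc (0, v)).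
have : nbhs t0 ((fun t : R => (t, u) : R * V) @^-1` U).
  by apply: pairc'; exact: open_nbhs_nbhs.
apply: filterS => t /= Utu Atu.
have pd : is_diff u (fun w => (t, w) : R * V) (fun v => (0, v)).
  exact: is_diff_pair.
have [_ ->] : differentiable (H t) u /\
    'd (H t) u = 'd (g \o (fun w => (t, w))) u :> (V -> W).
  apply: near_eq_diff; last by apply: differentiable_comp => //; exact: gd.
  near=> w; rewrite /= -Hg //; first by near: w; exact: Aslice.
  by near: w; apply: (pairc t); exact: open_nbhs_nbhs.
rewrite diff_comp //; last exact: gd.
by rewrite (diff_val (is_diff_def := pd)).
Unshelve. all: by end_near. Qed.

Lemma derive1_comp_diff (R : numFieldType) (V W : normedModType R) (k : R -> V)
    (g : V -> W) (s : R) (y : V) : differentiable k s -> k s = y ->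
  differentiable g y -> derive1 (g \o k) s = 'd g y (derive1 k s).
Proof.
move=> dk <- dg; rewrite !derive1E' //; last exact: differentiable_comp.
by rewrite diff_comp.
Qed.

Lemma derive1_diff (R : numFieldType) (V : normedModType R) (k : R -> V)
    (s a : R) : differentiable k s -> 'd k s a = a *: derive1 k s.
Proof.
move=> dk; rewrite derive1E' // -linearZ.
by congr ('d k s _); rewrite /GRing.scale /= mulr1.
Qed.

Lemma jacobian_comp (R : numFieldType) (m n k : nat)
    (f : 'rV[R]_m -> 'rV[R]_n) (g : 'rV[R]_n -> 'rV[R]_k) (x : 'rV[R]_m) :
  differentiable f x -> differentiable g (f x) ->
  'J (g \o f) x = 'J f x *m 'J g (f x).
Proof.
move=> df dg; apply/row_matrixP => i.
by rewrite !rowE mulmxA /jacobian !mul_rV_lin1 diff_comp.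
Qed.

Lemma within_continuous_near (T U : topologicalType) (A : set T) (f : T -> U)
    (B : set U) (x : T) : {within A, continuous f} -> A x -> open B -> B (f x) ->
  \forall y \near x, A y -> B (f y).
Proof.
move=> fc Ax oB Bfx; have := fc x B (open_nbhs_nbhs (conj oB Bfx)).
by rewrite /nbhs /= -nbhs_subspace_in.
Qed.

(** * Locally constant properties and determinants *)

(** The subset of A where P holds is relatively open, and so is its
    complement. *)
Lemma connected_locally_constant (T : topologicalType) (A : set T)
    (P : T -> Prop) : connected A ->
  (forall x, A x -> \forall y \near x, A y -> P y <-> P x) ->
  forall x y, A x -> A y -> P x -> P y.
Proof.
move=> Aconn Ploc x y Ax Ay Px.
suff BA : A `&` P = A by have := Ay; rewrite -BA => -[].
have openE (Q : T -> Prop) :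
    (forall z, A z -> Q z -> \forall w \near z, A w -> Q w) ->
    A `&` Q = A `&` [set w | A w -> Q w]°.
  move=> Qloc; rewrite eqEsubset; split=> z [Az]; last first.
    by move=> /interior_subset; move/(_ Az).
  by move=> Qz; split=> //; exact: Qloc.
apply: Aconn; first by exists x.
  exists [set w | A w -> P w]°; first exact: open_interior.
  by apply: openE => z Az Pz; apply: filterS (Ploc z Az) => w Pw Aw; apply/Pw.
exists (~` [set w | A w -> ~ P w]°); first exact/open_closedC/open_interior.
have /seteqP[E1 E2] : A `&` (~` P) = A `&` [set w | A w -> ~ P w]°.
  by apply: openE => z Az Pz; apply: filterS (Ploc z Az) => w Pw Aw /(Pw Aw).
rewrite eqEsubset; split=> z [Az Pz]; split=> //.
  by move=> Iz; have [] := E2 z (conj Az Iz).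
by apply: contrapT => nPz; apply: Pz; have [] := E1 z (conj Az nPz).
Qed.

Lemma det_continuous (R : realType) (T : topologicalType) (n : nat)
    (M : T -> 'M[R]_n) (x : T) :
  (forall i j, {for x, continuous (fun y => M y i j)}) ->
  {for x, continuous (fun y => \det (M y))}.
Proof.
move=> Mc; rewrite /continuous_at /determinant.
apply: cvg_big => [|s _]; first exact: add_continuous.
apply: cvgM; first exact: cvg_cst.
apply: cvg_big => [|i _]; last exact: Mc.
exact: mul_continuous.
Qed.

(** * Jacobians in charts *)

Section LocalJacobian.
Variables (R : realType) (S : surface R).
Implicit Types (c d e : chart R S) (f g : S -> S) (p : S).

Definition local_jacobian c d f p : 'M[R]_2 := 'J (d \o f \o cinv c) (c p).

Lemma smooth_to_near (V : normedModType R) (A : set V) (G : V -> S) c x :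
  smooth_to A G -> open A -> A x -> cdom c (G x) ->
  \forall y \near x, A y /\ cdom c (G y).
Proof.
move=> [Gc _] oA Ax cx.
have := within_continuous_near Gc Ax (cdom_open c) cx.
have := open_nbhs_nbhs (conj oA Ax).
by apply: filterS2 => y Ay /(_ Ay).
Qed.

Lemma smooth_to_differentiable (V : normedModType R) (A : set V) (G : V -> S)
    c x : smooth_to A G -> open A -> A x -> atlas c -> cdom c (G x) ->
  differentiable (c \o G) x.
Proof.
move=> Gs oA Ax ac cx; apply: smooth_on_differentiable (Gs.2 c ac) _.
exact: smooth_to_near.
Qed.

Lemma smooth_map_near f c d p : smooth_map f -> atlas c -> cdom c p ->
  cdom d (f p) -> \forall u \near c p, cimg c u /\ cdom d (f (cinv c u)).
Proof.
move=> fs ac cp dfp; apply: (smooth_to_near (fs c ac)).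
- exact: cimg_open.
- exact: cmap_img.
- by rewrite /= cmapK.
Qed.

Lemma smooth_map_differentiable f c d p : smooth_map f -> atlas c -> atlas d ->
  cdom c p -> cdom d (f p) -> differentiable (d \o f \o cinv c) (c p).
Proof.
move=> fs ac ad cp dfp; apply: (smooth_to_differentiable (fs c ac)) => //.
- exact: cimg_open.
- exact: cmap_img.
- by rewrite /= cmapK.
Qed.

(** In charts this is the smoothness of the atlas. *)
Lemma smooth_map_id : smooth_map (@id S).
Proof.
move=> c ac; split; last by move=> d ad; exact: atlas_smooth.
rewrite continuous_open_subspace; last exact: cimg_open.
by move=> u /set_mem; exact: cinv_continuous.
Qed.

(** Matrices act on row vectors from the right, hence the order of the product.
    The middle chart d cancels only near p, where f stays in its domain. *)
Lemma local_jacobian_comp f g c d e p : smooth_map f -> smooth_map g ->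
  atlas c -> atlas d -> atlas e ->
  cdom c p -> cdom d (f p) -> cdom e (g (f p)) ->
  local_jacobian c e (g \o f) p =
    local_jacobian c d f p *m local_jacobian d e g (f p).
Proof.
move=> fs gs ac ad ae cp dfp egfp; rewrite /local_jacobian.
have fd := smooth_map_differentiable fs ac ad cp dfp.
have gd := smooth_map_differentiable gs ad ae dfp egfp.
have pE : (d \o f \o cinv c) (c p) = d (f p) by rewrite /= cmapK.
have gd' : differentiable (e \o g \o cinv d) ((d \o f \o cinv c) (c p)).
  by rewrite pE.
have := jacobian_comp fd gd'; rewrite pE => <-.
have dcomp := differentiable_comp fd gd'.
rewrite /jacobian; apply: congr1; apply: (near_eq_diff _ dcomp).2.
apply: filterS (smooth_map_near fs ac cp dfp) => u [_ du] /=.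
by rewrite cmapK.
Qed.

Lemma local_jacobian_id_gt0 c d p : atlas c -> atlas d -> cdom c p ->
  cdom d p -> 0 < \det (local_jacobian c d id p).
Proof.
move=> ac ad cp dp; apply: (atlas_oriented ac ad); first exact: cmap_img.
by rewrite cmapK.
Qed.

(** Changing the target chart multiplies the Jacobian by that of a transition
    map of the oriented atlas. *)
Lemma local_jacobian_gt0_chart f c d e p : smooth_map f ->
  atlas c -> atlas d -> atlas e -> cdom c p -> cdom d (f p) -> cdom e (f p) ->
  0 < \det (local_jacobian c d f p) -> 0 < \det (local_jacobian c e f p).
Proof.
move=> fs ac ad ae cp dfp efp jd.
rewrite (local_jacobian_comp fs smooth_map_id ac ad ae cp dfp efp) det_mulmx.
exact: mulr_gt0 jd (local_jacobian_id_gt0 ad ae dfp efp).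
Qed.

(** Its product with the Jacobian of the inverse of f is the Jacobian of the
    identity. *)
Lemma local_jacobian_neq0 f c d p : diffeomorphism f ->
  atlas c -> atlas d -> cdom c p -> cdom d (f p) ->
  \det (local_jacobian c d f p) != 0.
Proof.
move=> [g [fK gK fs gs]] ac ad cp dfp.
have cgfp : cdom c (g (f p)) by rewrite fK.
have := local_jacobian_id_gt0 ac ac cp cp.
have -> : id = g \o f by apply/funext => q /=; rewrite fK.
rewrite (local_jacobian_comp fs gs ac ad ac cp dfp cgfp) det_mulmx.
by move=> /lt0r_neq0; rewrite mulf_eq0 negb_or => /andP[+ _].
Qed.

(** A diffeomorphism isotopic to the identity preserves the orientation: the
    sign of the Jacobian determinant of F t at p is locally constant in t, by
    continuity and non-vanishing, and it is positive at t = 0. *)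
Lemma isotopy_local_jacobian_gt0 (F : R -> S -> S) c d p : ambient_isotopy F ->
  atlas c -> atlas d -> cdom c p -> cdom d (F 1 p) ->
  0 < \det (local_jacobian c d (F 1) p).
Proof.
move=> [F0 Fdiff Fs] ac ad cp dFp.
have Fsm t : 0 <= t <= 1 -> smooth_map (F t) by move=> /Fdiff[g []].
pose A := `[0, 1]%classic : set R.
(* Quantifying over all charts at F t p makes the property independent of
   the chart e chosen near a given time t0 to prove that it is locally
   constant. *)
pose pos t := forall e, atlas e -> cdom e (F t p) ->
  0 < \det (local_jacobian c e (F t) p).
suff : pos 1 by exact.
apply: (@connected_locally_constant _ A pos _ _ 0).
- exact: segment_connected.
- move=> t0; rewrite /A /= in_itv /= => t01.
  have [e ae et0] := atlas_cover (F t0 p).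
  have posE t : 0 <= t <= 1 -> cdom e (F t p) ->
      pos t <-> 0 < \det (local_jacobian c e (F t) p).
    move=> t1 et; split=> [|je e' ae' e't]; first by apply.
    exact: local_jacobian_gt0_chart (Fsm t t1) ac ae ae' cp et e't je.
  have [Fc /(_ e ae) Fe] := Fs c ac.
  have [|t [[/= t1 _] et]|D [Dc DE]] := @smooth_on_slice R _ _ _
    (fun t => e \o F t \o cinv c) t0 (c p) Fe.
  + by split=> /=; [split=> //; exact: cmap_img | rewrite cmapK].
  + move: et; rewrite /= cmapK // => et.
    apply: filterS (smooth_map_near (Fsm t t1) ac cp et) => w [cw ew].
    by split=> /=; first split.
  pose J t : 'M[R]_2 := lin1_mx (D t).
  have JE t : 'd (e \o F t \o cinv c) (c p) = D t :> (_ -> _) ->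
      local_jacobian c e (F t) p = J t.
    exact: (@congr1 _ _ (@lin1_mx R 2 2)).
  have Fe0 : \forall t \near t0, 0 <= t <= 1 -> cdom e (F t p).
    have pairc : {for t0, continuous (fun t => (t, c p) : R * 'rV[R]_2)}.
      exact: pairl_continuous.
    have := @within_continuous_near _ _ _ _ (cdom e) (t0, c p) Fc
      (conj t01 (cmap_img cp)) (cdom_open e).
    rewrite /= cmapK // => /(_ et0) Q.
    have {}Q : \forall t \near t0, 0 <= t <= 1 /\ cimg c (c p) ->
      cdom e (F t (cinv c (c p))) by exact: (pairc _ Q).
    apply: filterS Q => t + t1.
    by rewrite cmapK //; apply; split=> //; exact: cmap_img.
  have J0 : local_jacobian c e (F t0) p = J t0.
    apply/JE/(nbhs_singleton DE); split=> /=; last by rewrite cmapK.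
    by split=> //; exact: cmap_img.
  have Jc : {for t0, continuous (fun t => \det (J t))}.
    apply: det_continuous => i j; rewrite /J /lin1_mx.
    under [X in {for _, continuous X}]funext do rewrite mxE.
    apply: (@continuous_comp _ _ _ (D^~ (delta_mx 0 i))
      (fun v : 'rV[R]_2 => v 0 j) t0); first exact: Dc.
    exact: coord_continuous.
  have Jsgn : \forall t \near t0, (0 < \det (J t)) = (0 < \det (J t0)).
    have := local_jacobian_neq0 (Fdiff t0 t01) ac ae cp et0.
    rewrite J0; case: ltgtP => // Jt0 _.
      by near=> t; near: t; exact: (cvgr_gt _ Jc).
    near=> t; apply/negbTE; rewrite -leNgt ltW //.
    by near: t; exact: (cvgr_lt _ Jc).
  near=> t => t1; rewrite in_itv /= in t1.
  have et : cdom e (F t p) by move: t1; near: t.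
  have Jt : local_jacobian c e (F t) p = J t.
    apply: JE.
    have : (0 <= t <= 1 /\ cimg c (c p)) /\ cdom e (F t (cinv c (c p))).
      by split; [split=> //; exact: cmap_img | rewrite cmapK].
    by near: t.
  rewrite (posE t t1 et) (posE t0 t01 et0) Jt J0.
  by rewrite (_ : (0 < \det (J t)) = (0 < \det (J t0))) //; near: t.
- by rewrite /A /= in_itv /= lexx ler01.
- by rewrite /A /= in_itv /= lexx ler01.
- have F00 : F 0 = id by apply/funext.
  by rewrite /pos F00 => e ae ep; exact: local_jacobian_id_gt0.
Unshelve. all: by end_near. Qed.

End LocalJacobian.

(** * Relabelling nanowords *)

Lemma word_iso_trans (T U X : eqType) (u : seq T) (v : seq U) (w : seq X) :
  word_iso u v -> word_iso v w -> word_iso u w.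
Proof.
move=> [f [finj vE]] [g [ginj wE]]; exists (g \o f); split; last first.
  by rewrite wE vE map_comp.
by move=> a b au bu /= gE; apply: finj => //; apply: ginj; rewrite ?vE ?map_f.
Qed.

(** Injectivity of f is not enough when T is empty, as an isomorphism involves
    a map defined on all letters, even for the empty word. *)
Lemma word_iso_map (T U X : eqType) (f : T -> U) (v : seq X) (w : seq T) :
  bijective f -> word_iso v (map f w) <-> word_iso v w.
Proof.
move=> [g fK gK]; split=> /word_iso_trans; apply.
  by exists g; split; [move=> a b _ _; exact: can_inj gK a b | rewrite mapK].
by exists f; split=> // a b _ _; exact: can_inj fK a b.
Qed.

Lemma fpowerset_imfset (T U : choiceType) (f : T -> U) (A : {fset T}) :
  injective f -> perm_eq (fpowerset (f @` A)%fset)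
    [seq (f @` B)%fset | B : {fset T} <- fpowerset A].
Proof.
move=> finj; apply: uniq_perm; first exact: fset_uniq.
  rewrite map_inj_uniq ?fset_uniq // => B C /fsetP BC.
  by apply/fsetP => a; have := BC (f a); rewrite !mem_imfset.
move=> C; rewrite fpowersetE; apply/idP/mapP => [/fsubsetP CA|[B]].
  exists [fset a in A | f a \in C]%fset.
    by rewrite fpowersetE; apply/fsubsetP => a; rewrite !inE => /andP[].
  apply/fsetP => b; apply/idP/imfsetP => [bC|[a /=]].
    have /imfsetP[a /= aA bE] := CA _ bC.
    by exists a; rewrite //= !inE aA -bE bC.
  by rewrite !inE => /andP[_ faC] ->.
by rewrite fpowersetE => BA ->; apply: subset_imfset; exact/fsubsetP.
Qed.

(** The sub-words of the relabelled nanoword are the relabelled sub-words, with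
    the same signs. *)
Lemma pairing_map (U : eqType) (T T' : choiceType) (f : T -> T') (v : seq U)
    (w : nanoword T) (w' : nanoword T') : bijective f -> w' = map f w :> seq T' ->
  {in (w : seq T), forall a, nsign w' (f a) = nsign w a} ->
  pairing v w' = pairing v w.
Proof.
move=> fbij w'E sgnE; have finj := bij_inj fbij; rewrite /pairing.
have -> : alphabet w' = (f @` alphabet w)%fset.
  apply/fsetP => b; rewrite !inE w'E.
  by apply/mapP/imfsetP => -[a aw ->]; exists a; rewrite ?inE // in aw *.
rewrite (perm_big _ (fpowerset_imfset _ finj)) big_map /=.
rewrite big_seq_cond [RHS]big_seq_cond; apply: eq_big => B /=; last first.
  rewrite fpowersetE => /andP[/fsubsetP Bw _].
  rewrite big_imfset /=; last by move=> a b _ _; exact: finj.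
  by apply: eq_big_seq => a /Bw; rewrite inE => /sgnE.
congr (_ && _); apply: asbool_equiv_eq.
rewrite -(word_iso_map v _ fbij) /subword w'E filter_map.
suff -> : [seq a <- w | preim f (mem (f @` B)%fset) a] = [seq a <- w | a \in B].
  by [].
by apply: eq_filter => a /=; rewrite mem_imfset.
Qed.

(** * Lifts of orientation-preserving diffeomorphisms of the circle *)

Section CircleLift.
Variables (R : realType) (h : R -> R).
Hypothesis h_diff : forall s, differentiable h s.
Hypothesis h_period : forall s, h (s + 1) = h s + 1.
Hypothesis h_gt0 : forall s, 0 < derive1 h s.

Lemma lift_lt : {mono h : s t / s < t}.
Proof.
apply: leW_mono; apply: le_mono => s t st.
apply: (@gtr0_derive1_lt_cc _ h s t) => //; rewrite ?in_itv /= ?lexx ?ltW //.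
- by move=> u _; apply/derivable1_diffP.
- by apply: continuous_subspaceT => u; exact: differentiable_continuous.
Qed.

Lemma lift_le : {mono h : s t / s <= t}.
Proof. by apply: le_mono => s t; rewrite lift_lt. Qed.

Lemma lift_inj : injective h.
Proof. by move=> s t /eqP; rewrite eq_le !lift_le -eq_le => /eqP. Qed.

Lemma lift_addz (s : R) (m : int) : h (s + m%:~R) = h s + m%:~R.
Proof.
have per (k : nat) u : h (u + k%:R) = h u + k%:R.
  elim: k u => [|k IHk] u; first by rewrite !addr0.
  by rewrite -natr1 !addrA h_period IHk.
case: m => k; first exact: per.
by rewrite NegzE mulrNz -[in RHS](subrK (k.+1%:R : R) s) per addrK.
Qed.

Lemma lift_same_time (s t : R) : same_time (h s) (h t) <-> same_time s t.
Proof.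
split=> /intrP[m mE]; apply/intrP; exists m.
  apply/eqP; rewrite subr_eq addrC; apply/eqP/lift_inj.
  by rewrite lift_addz -mE addrC subrK.
have -> : s = t + m%:~R by rewrite -mE addrC subrK.
by rewrite lift_addz addrC addKr.
Qed.

Lemma lift_surj (t : R) : exists s, h s = t.
Proof.
(* h maps [m, m + 1] onto [h 0 + m, h 0 + m + 1], which contains t. *)
pose m := Num.floor (t - h 0).
have m1 : m%:~R <= t - h 0 by exact: floor_le.
have m2 : t - h 0 < (m + 1)%:~R by exact: floorD1_gt.
have [|||s _ sE] := @IVT _ h m%:~R (m + 1)%:~R t.
- by rewrite ler_int lerDl.
- by apply: continuous_subspaceT => u; exact: differentiable_continuous.
- have hz k : h k%:~R = h 0 + k%:~R by rewrite -lift_addz add0r.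
  rewrite !hz ge_min le_max; apply/andP; split; apply/orP; [left|right]; lra.
- by exists s.
Qed.

End CircleLift.

(** * Transport of the word of a curve *)

Section Transport.
Variables (R : realType) (S : surface R) (f : S -> S) (G G' : pointed_curve S).
Hypothesis f_inj : injective f.

(** The reparametrization takes base G to a time with the same image as base G',
    which is not a double point; so the two times differ by an integer, by which
    the reparametrization may be shifted. *)
Lemma based_lift : carries f G G' -> exists h : R -> R,
  [/\ forall s, differentiable h s, forall s, h (s + 1) = h s + 1,
      forall s, 0 < derive1 h s, forall s, f (G s) = G' (h s) &
      h (base G) = base G'].
Proof.
move=> [fb [h0 [h0s h0p h0g h0E]]].
have [m mE] : exists m : int, base G' - h0 (base G) = m%:~R.
  apply/intrP; apply: contrapT => bm; apply: (@baseP _ _ G').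
  by exists (h0 (base G)) => //; rewrite -fb h0E.
have h0d s : differentiable h0 s.
  by apply: smooth_on_differentiable h0s _; exact: filterT.
exists (fun s => h0 s + m%:~R); split=> [s|s|s|s|].
- by apply: differentiableD => //; exact: differentiable_cst.
- by rewrite h0p addrAC.
- have dh0 : derivable h0 s 1 by exact/derivable1_diffP.
  by rewrite derive1E (deriveD dh0 (derivable_cst _ _ _)) derive_cst addr0 -derive1E.
- by rewrite curve_periodicZ h0E.
- by rewrite -mE addrC subrK.
Qed.

Variable h : R -> R.
Hypothesis h_diff : forall s, differentiable h s.
Hypothesis h_period : forall s, h (s + 1) = h s + 1.
Hypothesis h_gt0 : forall s, 0 < derive1 h s.
Hypothesis hE : forall s, f (G s) = G' (h s).
Hypothesis h_base : h (base G) = base G'.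

Lemma lift_turn s : base G' < h s < base G' + 1 = (base G < s < base G + 1).
Proof. by rewrite -h_base -h_period !(lift_lt h_diff h_gt0). Qed.

Lemma passes_double_lift s : passes_double G' (h s) <-> passes_double G s.
Proof.
split=> -[t st Gst].
  have [u uE] := lift_surj h_diff h_period t; rewrite -uE in st Gst.
  exists u; first by rewrite -(lift_same_time h_diff h_period h_gt0).
  by apply: f_inj; rewrite !hE.
exists (h t); first by rewrite (lift_same_time h_diff h_period h_gt0).
by rewrite -!hE Gst.
Qed.

(** The set of passages of G' is the image by h of that of G, and h is
    increasing.  Both sets are finite, or both are infinite and then the two
    lists are empty by convention. *)
Lemma passages_lift : passages G' = map h (passages G).
Proof.
pose D (G : pointed_curve S) :=
  [set s | base G < s < base G + 1 /\ passes_double G s].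
have DE : D G' = h @` D G.
  apply/seteqP; split=> [t [tb tG]|_ [s [sb sG] <-]]; last first.
    by split; rewrite ?lift_turn // passes_double_lift.
  have [s sE] := lift_surj h_diff h_period t; exists s => //.
  by split; rewrite -?lift_turn -?passes_double_lift sE.
have h_inj : injective h by exact: lift_inj.
rewrite /passages -/(D G) -/(D G').
have [Dfin|Dinf] := pselect (finite_set (D G)).
  rewrite (map_sort (lift_le h_diff h_gt0)); apply/perm_sort_leP.
  rewrite DE fset_set_image //; apply: uniq_perm; first exact: fset_uniq.
    by rewrite map_inj_uniq ?fset_uniq.
  by move=> t; apply/imfsetP/mapP => -[s sD ->]; exists s.
have infE A : ~ finite_set A -> fset_set A = fset0 :> {fset R}.
  by rewrite /fset_set; case: pselect.
rewrite (infE _ Dinf) infE //= DE => DEfin; apply: Dinf.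
have -> : D G = h @^-1` (h @` D G).
  by rewrite eqEsubset; split=> [s Ds|s [t Dt /h_inj <-] //]; exists s.
by apply: finite_preimage => // s t _ _; exact: h_inj.
Qed.

Lemma curve_word_lift : curve_word G' = map f (curve_word G).
Proof.
rewrite /curve_word passages_lift -!map_comp.
by apply: eq_map => s /=; rewrite hE.
Qed.

End Transport.

(** * Transport of the signs of crossings *)

Lemma frame_det_mulmx (R : realType) (J : 'M[R]_2) (u v u' v' : 'rV[R]_2)
    (a b : R) : u *m J = a *: u' -> v *m J = b *: v' ->
  \det (col_mx u v) * \det J = a * b * \det (col_mx u' v').
Proof.
move=> uE vE; rewrite -det_mulmx mul_col_mx uE vE.
have -> : col_mx (a *: u') (b *: v') =
    block_mx a%:M 0 0 b%:M *m col_mx u' v'.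
  by rewrite mul_block_col !mul_scalar_mx !mul0mx addr0 add0r.
by rewrite det_mulmx det_ublock !det_scalar1.
Qed.

Section Crossings.
Variables (R : realType) (S : surface R) (f : S -> S) (G G' : pointed_curve S).
Variable h : R -> R.
Hypothesis f_inj : injective f.
Hypothesis f_smooth : smooth_map f.
Hypothesis f_orient : forall c d p, atlas c -> atlas d -> cdom c p ->
  cdom d (f p) -> 0 < \det (local_jacobian c d f p).
Hypothesis h_diff : forall s, differentiable h s.
Hypothesis h_period : forall s, h (s + 1) = h s + 1.
Hypothesis h_gt0 : forall s, 0 < derive1 h s.
Hypothesis hE : forall s, f (G s) = G' (h s).
Hypothesis h_base : h (base G) = base G'.

Lemma curve_differentiable (H : closed_curve S) c s : atlas c ->
  cdom c (H s) -> differentiable (c \o H) s.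
Proof.
by move=> ac cs; apply: (smooth_to_differentiable (curve_smooth H)) => //;
   exact: openT.
Qed.

(** The chain rule applied to f \o G = G' \o h, read in the charts c and d. *)
Lemma velocity_lift c d s : atlas c -> atlas d -> cdom c (G s) ->
  cdom d (f (G s)) ->
  velocity c G s *m local_jacobian c d f (G s) =
    derive1 h s *: velocity d G' (h s).
Proof.
move=> ac ad cs ds.
have dGc : differentiable (c \o G) s by exact: curve_differentiable.
have dGd : differentiable (d \o G') (h s).
  by apply: curve_differentiable; rewrite -?hE.
have df := smooth_map_differentiable f_smooth ac ad cs ds.
have near_s : \forall t \near s,
    (d \o G' \o h) t = (d \o f \o cinv c \o (c \o G)) t.
  have := smooth_to_near (curve_smooth G) openT I cs.
  by apply: filterS => t [_ ct]; rewrite /= cmapK // hE.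
rewrite /velocity /local_jacobian /jacobian mul_rV_lin1.
rewrite -(derive1_diff _ dGd) -(derive1_comp_diff (h_diff s) (erefl _) dGd).
rewrite -(derive1_comp_diff dGc (erefl _) df) !derive1E.
by apply/esym; apply: near_eq_derive.
Qed.

(** Both velocity vectors at a double point are transformed by the same matrix,
    of positive determinant, up to positive factors. *)
Lemma frame_det_lift c d s t : atlas c -> atlas d -> cdom c (G s) ->
  cdom d (f (G s)) -> G s = G t ->
  (frame_det d G' (h s) (h t) < 0) = (frame_det c G s t < 0).
Proof.
move=> ac ad cs ds st; have ct := cs; have dt := ds; rewrite st in ct dt.
have vt := velocity_lift ac ad ct dt; rewrite -st in vt.
have E : frame_det c G s t * \det (local_jacobian c d f (G s)) =
    derive1 h s * derive1 h t * frame_det d G' (h s) (h t).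
  exact: frame_det_mulmx (velocity_lift ac ad cs ds) vt.
have := pmulr_llt0 (frame_det c G s t) (f_orient ac ad cs ds).
by rewrite E pmulr_rlt0 //; exact: mulr_gt0.
Qed.

(** A negative crossing may be witnessed in any chart, so those of G and G' are
    exchanged by reading the frames in arbitrary charts at p and f p. *)
Lemma curve_sign_lift p : curve_sign G' (f p) = curve_sign G p.
Proof.
have hlt := lift_lt h_diff h_gt0.
have turn s : (base G' < h s) = (base G < s) by rewrite -h_base hlt.
have turn1 s : (h s < base G' + 1) = (s < base G + 1).
  by rewrite -h_base -h_period hlt.
rewrite /curve_sign.
suff -> : negative_crossing G' (f p) = negative_crossing G p by [].
apply/propext; split.
  move=> [s' [t' [d [[bs st tb Gs Gt] [ad dp neg]]]]].
  have [s sE] := lift_surj h_diff h_period s'.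
  have [t tE] := lift_surj h_diff h_period t'.
  rewrite -{}sE -{}tE in bs st tb Gs Gt neg *.
  have [Gsp Gtp] : G s = p /\ G t = p by split; apply: f_inj; rewrite hE.
  have [c ac cp] := atlas_cover p.
  exists s, t, c; split; first split=> //.
  - by rewrite -turn.
  - by rewrite -hlt.
  - by rewrite -turn1.
  have cs : cdom c (G s) by rewrite Gsp.
  have ds : cdom d (f (G s)) by rewrite Gsp.
  have st' : G s = G t by rewrite Gsp Gtp.
  by split; [exact: ac | exact: cp | rewrite -(frame_det_lift ac ad cs ds st')].
move=> [s [t [c [[bs st tb Gs Gt] [ac cp neg]]]]].
have [d ad dp] := atlas_cover (f p).
exists (h s), (h t), d; split; first split.
- by rewrite turn.
- by rewrite hlt.
- by rewrite turn1.
- by rewrite -hE Gs.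
- by rewrite -hE Gt.
have cs : cdom c (G s) by rewrite Gs.
have ds : cdom d (f (G s)) by rewrite Gs.
have st' : G s = G t by rewrite Gs Gt.
by split; [exact: ad | exact: dp | rewrite (frame_det_lift ac ad cs ds st')].
Qed.

End Crossings.

Theorem theorem2p3 (R : realType) (S : surface R) (n : nat) (hn : (1 <= n)%N)
    (P : comAlgType rat) (x : gauss_class n -> P) (G G' : pointed_curve S) :
  surface_isotopic G G' -> I_ x G = I_ x G'.
Proof.
move=> [F Fiso FG].
have [_ Fdiff _] := Fiso.
have [|g [fK gK f_smooth _]] := Fdiff 1; first by rewrite ler01 lexx.
have f_inj := can_inj fK.
have f_orient c d p := @isotopy_local_jacobian_gt0 R S F c d p Fiso.
have [h [h_diff h_period h_gt0 hE h_base]] := based_lift FG.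
have pairingE (v : seq 'I_n) :
    pairing v (curve_nanoword G') = pairing v (curve_nanoword G).
  apply: (pairing_map (f := F 1)); first by exists g.
    exact: (curve_word_lift f_inj h_diff h_period h_gt0 hE h_base : _ = _).
  move=> p _.
  exact: (curve_sign_lift f_inj f_smooth f_orient h_diff h_period h_gt0 hE
    h_base).
rewrite /I_ /pairing_lin; apply: eq_bigr => k _.
exact: (congr1 (fun z : int => _ * z%:~R) (esym (pairingE _))).
Qed.
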